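(* Let $q\in(0,1/2)$, let $k\ge2$ be an integer, $m=2^k$, $r=\tfrac12q^k$, and let $B=[b_{ij}]=A_{11}+A_{12}J_{m/2}\in\mathbb{R}^{\frac m2\times\frac m2}$ be the matrix defined in the context. Then the entries of $B$ satisfy, for all $1\le i,j\le m/2$, $$\log\frac{1}{q(1-q)}<\log\frac{1}{(1-q)(q-2r)}\le b_{ij}\le\log\frac{1}{r(1-2q+2r)}<\log\frac{1}{r(1-2q)},$$ and they decay away from the diagonal in each row and column, i.e., for all $1\le i,j\le m/2$, $$b_{i,1}<\dots<b_{i,i-1}<b_{i,i},\qquad b_{i,i}>b_{i,i+1}>\dots>b_{i,m/2},$$ $$b_{1,j}<\dots<b_{j-1,j}<b_{j,j},\qquad b_{j,j}>b_{j+1,j}>\dots>b_{m/2,j}.$$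
   Context: For $q\in(0,1/2)$ set $E_0=[0,1]$ and recursively $E_k=qE_{k-1}\cup(qE_{k-1}+1-q)$ for $k\ge1$. The set $E_k$ consists of $m=2^k$ disjoint closed intervals, numbered from left to right, each of length $q^k$. For fixed $k$, $w_1<\dots<w_m$ denote the midpoints of these intervals, and $r=r_k=\tfrac12q^k$. Let $A=[a_{ij}]\in\mathbb{R}^{m\times m}$ be the matrix with $a_{ii}=-\log r$ and $a_{ij}=-\log|w_i-w_j|$ for $i\ne j$. Partition $A=\begin{bmatrix} A_{11} & A_{12} \\ A_{21} & A_{22} \end{bmatrix}$ into blocks of size $\frac m2\times\frac m2$, let $J_{m/2}\in\mathbb{R}^{\frac m2\times\frac m2}$ be the exchange matrix (ones on the anti-diagonal, zeros elsewhere), and set $B=A_{11}+A_{12}J_{m/2}$. *)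

(* Defs.v *)
From HB Require Import structures.
From mathcomp Require Import all_boot all_order all_algebra.
From mathcomp Require Import boolp classical_sets set_interval reals exp.
From mathcomp Require Import ring lra zify.

Set Implicit Arguments.
Unset Strict Implicit.
Unset Printing Implicit Defensive.

Import Order.TTheory GRing.Theory Num.Theory.

Local Open Scope classical_set_scope.
Local Open Scope ring_scope.

Fixpoint preCantor (R : realType) (q : R) (k : nat) : set R :=
  if k is k'.+1 then
    [set q * x | x in preCantor q k'] `|` [set q * x + 1 - q | x in preCantor q k']
  else `[0, 1]%classic.

Definition radius (R : realType) (q : R) (k : nat) : R := 2^-1 * q ^+ k.

(* The closed intervals of radius r centred at the w i are pairwise disjoint,
   numbered from left to right, and their union is E. *)
Definition consists_of_intervals (R : realType) (E : set R) (m : nat)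
    (w : 'I_m -> R) (r : R) : Prop :=
  [/\ forall i j : 'I_m, (i < j)%N -> w i < w j,
      trivIset [set: 'I_m] (fun i => `[w i - r, w i + r]%classic) &
      E = \bigcup_(i in [set: 'I_m]) `[w i - r, w i + r]%classic].

Definition logdist_mx (R : realType) (m : nat) (w : 'I_m -> R) (r : R) : 'M[R]_m :=
  \matrix_(i < m, j < m) if i == j then - ln r else - ln `|w i - w j|.

Definition exchange_mx (R : realType) (n : nat) : 'M[R]_n :=
  \matrix_(i < n, j < n) (j == rev_ord i)%:R.

Lemma expn2_halves (k : nat) : (1 < k)%N -> (2 ^ k = (2 ^ k)./2 + (2 ^ k)./2)%N.
Proof. by case: k => // k _; rewrite expnS mul2n doubleK addnn. Qed.

Definition fold_mx (R : realType) (m n : nat) (e : m = (n + n)%N) (A : 'M[R]_m) : 'M[R]_n :=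
  let A' := castmx (e, e) A in
  ulsubmx A' + ursubmx A' *m exchange_mx R n.

(* Explicit midpoints; midpoint_consists shows that the family required by
   consists_of_intervals exists for preCantor. *)
Fixpoint midpoint (R : realType) (q : R) (k i : nat) : R :=
  if k is k'.+1 then
    if (i < 2 ^ k')%N then q * midpoint q k' i
    else q * midpoint q k' (i - 2 ^ k') + 1 - q
  else 2^-1.

Lemma midpoint_bounds (R : realType) (q : R) (k i : nat) : 0 < q -> q < 2^-1 ->
  radius q k <= midpoint q k i /\ midpoint q k i <= 1 - radius q k.
Proof.
rewrite /radius => q0 q1; elim: k i => [|k IH] i /=; first by rewrite expr0; lra.
case: ifP => _; rewrite exprS.
  by have [] := IH i; nra.
by have [] := IH (i - 2 ^ k)%N; nra.
Qed.

Lemma midpoint_gap (R : realType) (q : R) (k i j : nat) : 0 < q -> q < 2^-1 ->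
  (i < j < 2 ^ k)%N -> midpoint q k i + radius q k < midpoint q k j - radius q k.
Proof.
rewrite /radius => q0 q1; elim: k i j => [|k IH] i j /=; first by case: j => //; lia.
move=> /andP[ij jk]; rewrite exprS.
have [jl|jl] := ltnP j (2 ^ k).
  by rewrite (ltn_trans ij jl); have := IH i j; rewrite ij jl => /(_ isT); nra.
have [il|il] := ltnP i (2 ^ k).
  have [_] := midpoint_bounds k i q0 q1.
  have [+ _] := midpoint_bounds k (j - 2 ^ k) q0 q1.
  by rewrite /radius; nra.
have /IH : (i - 2 ^ k < j - 2 ^ k < 2 ^ k)%N.
  by move: jk; rewrite expnS => jk; apply/andP; split; lia.
by nra.
Qed.

Lemma midpoint_consists (R : realType) (q : R) (k : nat) : 0 < q -> q < 2^-1 ->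
  consists_of_intervals (preCantor q k) (fun i : 'I_(2 ^ k) => midpoint q k i)
    (radius q k).
Proof.
move=> q0 q1; have r0 : 0 < radius q k by rewrite /radius mulr_gt0 ?exprn_gt0 ?invr_gt0.
have gap (i j : 'I_(2 ^ k)) : (i < j)%N ->
    midpoint q k i + radius q k < midpoint q k j - radius q k.
  by move=> ij; apply: midpoint_gap => //; rewrite ij ltn_ord.
split.
- by move=> i j /gap; lra.
- move=> i j _ _ [x []] /=; rewrite !in_itv /= => /andP[x1 x2] /andP[x3 x4].
  by apply/val_inj; case: (ltngtP i j) => // /gap gp; exfalso; move: (x : R) x1 x2 x3 x4 gp => {}x; lra.
have memE x : preCantor q k x <-> exists2 i, (i < 2 ^ k)%N &
    midpoint q k i - radius q k <= x <= midpoint q k i + radius q k.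
  rewrite /radius {r0 gap}; elim: k x => [|k IH] x /=.
    rewrite expr0 in_itv /=; split=> [/andP[? ?]|[i _ /andP[? ?]]].
      by exists 0%N => //; apply/andP; split; lra.
    by apply/andP; split; lra.
  rewrite exprS; split.
    case=> -[y /IH[i ik /andP[y1 y2]] <-].
      exists i; first by rewrite expnS; lia.
      by rewrite ik; apply/andP; split; nra.
    exists (i + 2 ^ k)%N; first by rewrite expnS; lia.
    rewrite ifF ?addnK; last by lia.
    by apply/andP; split; nra.
  case=> i; rewrite expnS; move=> ik2; case: ltnP => ik /andP[x1 x2].
    left; exists (x / q); last by field; lra.
    apply/IH; exists i => //.
    by rewrite ler_pdivlMr // ler_pdivrMr //; apply/andP; split; nra.
  right; exists ((x - 1 + q) / q); last by field; lra.
  apply/IH; exists (i - 2 ^ k)%N; first by lia.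
  by rewrite ler_pdivlMr // ler_pdivrMr //; apply/andP; split; nra.
apply/seteqP; split=> x.
  by move=> /memE[i ik h]; exists (Ordinal ik) => //=; rewrite in_itv.
by move=> [i _ /=]; rewrite in_itv /= => h; apply/memE; exists i.
Qed.

(* Main.v *)
Require Import Defs.
From HB Require Import structures.
From mathcomp Require Import all_boot all_order all_algebra.
From mathcomp Require Import boolp classical_sets set_interval reals exp.
From mathcomp Require Import ring lra zify.

Set Implicit Arguments.
Unset Strict Implicit.
Unset Printing Implicit Defensive.

Import Order.TTheory GRing.Theory Num.Theory.

Local Open Scope ring_scope.

(** Let [x_i = 1/2 - w_i].  The midpoints are symmetric about [1/2], so folding
    by the exchange matrix pairs the distance from [w_i] to [w_j] with the
    distance from [w_i] to the mirror image [1 - w_j].  For [i <> j] the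
    product of the two distances is a difference of squares,
    [`|w_i - w_j| * (1 - w_i - w_j) = `|x_i ^ 2 - x_j ^ 2|],
    and for [i = j] it is [r * (2 * x_i)], since [r] stands in for the first
    distance.  Thus [b_ij = - ln (square_gap x r i j)] ([fold_logdist_mxE]).

    On the left half the [x_i] are positive and decreasing, so a difference of
    squares grows as one index moves away from the other.  It also exceeds the
    diagonal value: disjointness of the intervals gives [`|x_i - x_j| > 2 * r],
    while [x_i + x_j > x_i].  This is the decay along rows ([square_gap_decr],
    [square_gap_incr]), and along columns by symmetry.  The bounds follow from
    [1/2 - q + r <= x_i <= 1/2 - r]: each row is smallest on the diagonal, where
    [2 * r * x_i >= r * (1 - 2 * q + 2 * r)], and off the diagonal no value
    exceeds the difference of the squares of the two end values,
    [(1 - q) * (q - 2 * r)].  That number also dominates the diagonal, because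
    [2 * r = q ^ k <= q ^ 2].

    The statement quantifies over every [w] that enumerates the intervals.
    Such a [w] is unique ([consists_of_intervals_unique]), hence it is the explicit
    family [midpoint], whose reflection symmetry and location in the left half
    come from the recursion. *)

(** * Uniqueness of the enumeration of intervals *)

(** At the least index where the families might differ, the left endpoint of
    the interval lying further left cannot be covered by the other family: the
    intervals before it are the common ones, disjoint from it, and the
    intervals from it on start too late. *)
Lemma consists_of_intervals_le (R : realType) (E : set R) (m : nat)
    (v w : 'I_m -> R) (r : R) (i : 'I_m) : 0 <= r ->
  consists_of_intervals E v r -> consists_of_intervals E w r ->
  (forall j : 'I_m, (j < i)%N -> v j = w j) -> w i <= v i.
Proof.
move=> r0 [_ vdisj vE] [winc _ wE] vw; rewrite leNgt; apply/negP => lt_vw.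
have vi : `[v i - r, v i + r]%classic (v i - r).
  by rewrite /= in_itv /=; apply/andP; split; lra.
have : E (v i - r) by rewrite vE; exists i.
rewrite wE => -[j _ wj]; case: (ltnP j i) => [ji | ij].
  have eij : i = j.
    by apply: vdisj => //; exists (v i - r); split; rewrite // vw.
  by move: ji; rewrite eij ltnn.
have : w i <= w j.
  by move: ij; rewrite leq_eqVlt => /predU1P[/val_inj -> // | /winc/ltW].
by move: wj; rewrite /= in_itv /= => /andP[]; lra.
Qed.

Lemma consists_of_intervals_unique (R : realType) (E : set R) (m : nat)
    (v w : 'I_m -> R) (r : R) : 0 <= r ->
  consists_of_intervals E v r -> consists_of_intervals E w r -> v =1 w.
Proof.
move=> r0 hv hw i; have [n] := ubnP i.
elim: n i => // n IH i; rewrite ltnS => le_in.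
have vw (j : 'I_m) : (j < i)%N -> v j = w j.
  by move=> ji; apply: IH; apply: leq_trans ji le_in.
apply/eqP; rewrite eq_le (consists_of_intervals_le r0 hv hw vw) andbT.
by apply: (consists_of_intervals_le r0 hw hv) => j /vw.
Qed.

(** * Midpoints of the Cantor intervals *)

Lemma midpoint_reflect (R : realType) (q : R) (k i : nat) : (i < 2 ^ k)%N ->
  midpoint q k (2 ^ k - i.+1) = 1 - midpoint q k i.
Proof.
elim: k i => [|k IH] i /=; first by lra.
rewrite expnS => ik; case: (ltnP i (2 ^ k)) => il.
  rewrite ifF; last by lia.
  have -> : (2 * 2 ^ k - i.+1 - 2 ^ k = 2 ^ k - i.+1)%N by lia.
  by rewrite IH //; ring.
rewrite ifT; last by lia.
have -> : (2 * 2 ^ k - i.+1 = 2 ^ k - (i - 2 ^ k).+1)%N by lia.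
by rewrite IH; [ring | lia].
Qed.

(** The left half of the [k]-th family is the previous family scaled by [q]. *)
Lemma midpoint_left_bounds (R : realType) (q : R) (k i : nat) :
  0 < q -> q < 2^-1 -> (i < (2 ^ k)./2)%N ->
  radius q k <= midpoint q k i /\ midpoint q k i <= q - radius q k.
Proof.
move=> q0 q1; case: k => // k; rewrite expnS mul2n doubleK /= => ->.
have [] := midpoint_bounds k i q0 q1.
by rewrite /radius exprS; split; nra.
Qed.

(** * Entries of the folded matrix *)

Lemma fold_mxE (R : realType) (m n : nat) (e : m = (n + n)%N) (A : 'M[R]_m)
    (i j : 'I_n) :
  fold_mx e A i j =
    A (cast_ord (esym e) (lshift n i)) (cast_ord (esym e) (lshift n j)) +
    A (cast_ord (esym e) (lshift n i))
      (cast_ord (esym e) (rshift n (rev_ord j))).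
Proof.
rewrite /fold_mx !mxE castmxE; congr (_ + _).
rewrite (bigD1 (rev_ord j)) //= big1 => [|l lj].
  by rewrite !mxE castmxE rev_ordK eqxx mulr1 addr0.
rewrite !mxE; case: eqP => [jl | _]; last by rewrite mulr0.
by move: lj; rewrite jl rev_ordK eqxx.
Qed.

(** The product of the two distances that the entry [(i, j)] of the folded
    matrix combines, in terms of the distances [x] to the centre of symmetry. *)
Definition square_gap (R : realType) (n : nat) (x : 'I_n -> R) (r : R)
    (i j : 'I_n) : R :=
  if i == j then 2 * r * x i else `|x i ^+ 2 - x j ^+ 2|.

Lemma fold_logdist_mxE (R : realType) (m n : nat) (e : m = (n + n)%N)
    (w : 'I_m -> R) (r : R) (i j : 'I_n) :
  let x i := 2^-1 - w (cast_ord (esym e) (lshift n i)) in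
  0 < r -> 0 < x i -> 0 < x j -> (i != j -> x i != x j) ->
  w (cast_ord (esym e) (rshift n (rev_ord j))) = 2^-1 + x j ->
  fold_mx e (logdist_mx w r) i j = - ln (square_gap x r i j).
Proof.
move=> x r0; rewrite fold_mxE !mxE.
have cinj (a b : 'I_(n + n)) : (cast_ord (esym e) a == cast_ord (esym e) b) = (a == b).
  by apply: inj_eq; apply: cast_ord_inj.
rewrite !cinj eq_lrshift eq_lshift => xi xj xij ->.
set wi := w (cast_ord _ (lshift n i)); set wj := w (cast_ord _ (lshift n j)).
have -> : wi = 2^-1 - x i by rewrite /x /wi; ring.
have -> : wj = 2^-1 - x j by rewrite /x /wj; ring.
have -> : 2^-1 - x i - (2^-1 + x j) = - (x i + x j) by ring.
have s0 : 0 < x i + x j by apply: addr_gt0.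
rewrite normrN (gtr0_norm s0) /square_gap; case: eqP => [eij | /eqP /xij nij].
  by rewrite -opprD -lnM ?posrE // -eij; congr (- ln _); ring.
have d0 : 0 < `|x i - x j| by rewrite normr_gt0 subr_eq0.
have -> : 2^-1 - x i - (2^-1 - x j) = - (x i - x j) by ring.
rewrite normrN -opprD -lnM ?posrE //; congr (- ln _).
by rewrite subr_sqr normrM (gtr0_norm s0).
Qed.

(** * Differences of squares of a decreasing family *)

Section SquareGap.

Variables (R : realType) (n : nat) (x : 'I_n -> R) (r : R).
Hypothesis r_gt0 : 0 < r.
Hypothesis x_gt0 : forall i, 0 < x i.
Hypothesis x_gap : forall i j : 'I_n, (i < j)%N -> 2 * r < x i - x j.

Lemma square_gapC (i j : 'I_n) : square_gap x r i j = square_gap x r j i.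
Proof. by rewrite /square_gap eq_sym distrC; case: eqP => // ->. Qed.

Lemma sqr_decr (i j : 'I_n) : (i < j)%N -> x j ^+ 2 < x i ^+ 2.
Proof.
move=> ij; rewrite ltr_pXn2r ?nnegrE ?ltW //.
by have := x_gap ij; have := r_gt0; lra.
Qed.

Lemma square_gap_lt (i j : 'I_n) : (i < j)%N ->
  square_gap x r i j = x i ^+ 2 - x j ^+ 2.
Proof.
move=> ij; rewrite /square_gap ifF; last by apply/eqP => eij; rewrite eij ltnn in ij.
by apply: gtr0_norm; rewrite subr_gt0 sqr_decr.
Qed.

(** The gap condition enters through the factor [x i - x j].  Dominating the sum
    of the two diagonal values settles the comparison with either of them, so
    the same bound serves on both sides of the diagonal. *)
Lemma square_gap_gt_diag (i j : 'I_n) : (i < j)%N ->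
  2 * r * x i + 2 * r * x j < square_gap x r i j.
Proof.
move=> ij; rewrite square_gap_lt // subr_sqr -mulrDr ltr_pM2r ?x_gap //.
exact: addr_gt0.
Qed.

Lemma diag_gt0 (i : 'I_n) : 0 < 2 * r * x i.
Proof. by rewrite !mulr_gt0. Qed.

Lemma square_gap_gt0 (i j : 'I_n) : 0 < square_gap x r i j.
Proof.
wlog ij : i j / (i <= j)%N.
  by move=> H; have [/H // | /ltnW/H] := leqP i j; rewrite square_gapC.
move: ij; rewrite leq_eqVlt => /predU1P[/val_inj -> | ij].
  by rewrite /square_gap eqxx diag_gt0.
exact: lt_trans (addr_gt0 (diag_gt0 i) (diag_gt0 j)) (square_gap_gt_diag ij).
Qed.

Lemma square_gap_decr (i j j' : 'I_n) : (j < j' <= i)%N ->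
  square_gap x r i j' < square_gap x r i j.
Proof.
case/andP=> jj'; rewrite leq_eqVlt => /predU1P[/val_inj <- | j'i].
  rewrite [ltRHS]square_gapC; apply: lt_trans (square_gap_gt_diag jj').
  by rewrite /square_gap eqxx ltrDr diag_gt0.
rewrite ![square_gap x r i _]square_gapC !square_gap_lt ?(ltn_trans jj') //.
by rewrite ltrD2r sqr_decr.
Qed.

Lemma square_gap_incr (i j j' : 'I_n) : (i <= j < j')%N ->
  square_gap x r i j < square_gap x r i j'.
Proof.
case/andP=> ij jj'; move: ij; rewrite leq_eqVlt => /predU1P[/val_inj -> | ij].
  apply: lt_trans (square_gap_gt_diag jj').
  by rewrite /square_gap eqxx ltrDl diag_gt0.
rewrite !square_gap_lt //; last exact: ltn_trans ij jj'.
by rewrite ltrD2l ltrN2 sqr_decr.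
Qed.

Lemma square_gap_ge (a : R) (i j : 'I_n) : (forall l, a <= x l) ->
  2 * r * a <= square_gap x r i j.
Proof.
move=> ax; have le_diag : 2 * r * a <= square_gap x r i i.
  by rewrite /square_gap eqxx ler_pM2l // mulr_gt0.
apply: (le_trans le_diag); case: (ltngtP i j) => [ij | ji | /val_inj -> //].
  by apply/ltW/square_gap_incr; rewrite leqnn.
by apply/ltW/square_gap_decr; rewrite ji leqnn.
Qed.

Lemma square_gap_le (a b : R) (i j : 'I_n) : 0 <= a ->
  (forall l, a <= x l <= b) -> 2 * r * b <= b ^+ 2 - a ^+ 2 ->
  square_gap x r i j <= b ^+ 2 - a ^+ 2.
Proof.
move=> a0 axb diag; wlog ij : i j / (i <= j)%N.
  by move=> H; have [/H // | /ltnW/H] := leqP i j; rewrite square_gapC.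
move: (axb i) (axb j) => /andP[ai ib] /andP[aj jb].
move: ij; rewrite leq_eqVlt => /predU1P[/val_inj eij | ij].
  rewrite eij /square_gap eqxx; apply: le_trans diag.
  by rewrite ler_pM2l // mulr_gt0.
have b0 : 0 <= b := le_trans a0 (le_trans ai ib).
by rewrite square_gap_lt // lerB // ler_pXn2r // nnegrE ltW.
Qed.

End SquareGap.

(** * Bounds and decay of the folded matrix *)

Theorem theorem3p5 (R : realType) (q : R) (hq0 : 0 < q) (hq1 : q < 1 / 2)
    (k : nat) (hk : (2 <= k)%N) (w : 'I_(2 ^ k) -> R)
    (hw : consists_of_intervals (preCantor q k) w (radius q k)) :
  let r := radius q k in
  let B := fold_mx (expn2_halves hk) (logdist_mx w r) in
  (forall i j : 'I_((2 ^ k)./2),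
     [/\ ln (1 / (q * (1 - q))) < ln (1 / ((1 - q) * (q - 2 * r))),
         ln (1 / ((1 - q) * (q - 2 * r))) <= B i j,
         B i j <= ln (1 / (r * (1 - 2 * q + 2 * r))) &
         ln (1 / (r * (1 - 2 * q + 2 * r))) < ln (1 / (r * (1 - 2 * q)))]) /\
  (forall i j j' : 'I_((2 ^ k)./2), (j < j' <= i)%N -> B i j < B i j') /\
  (forall i j j' : 'I_((2 ^ k)./2), (i <= j < j')%N -> B i j' < B i j) /\
  (forall j i i' : 'I_((2 ^ k)./2), (i < i' <= j)%N -> B i j < B i' j) /\
  (forall j i i' : 'I_((2 ^ k)./2), (j <= i < i')%N -> B i' j < B i j).
Proof.
move=> r B.
have q1 : q < 2^-1 by rewrite -[2^-1]mul1r.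
have r0 : 0 < r by rewrite /r /radius mulr_gt0 ?exprn_gt0 ?invr_gt0.
have wE : w =1 fun i : 'I_(2 ^ k) => midpoint q k i.
  by apply: consists_of_intervals_unique hw (midpoint_consists k hq0 q1); apply: ltW.
(* k >= 2 enters here: for k = 1 the value q - 2 * r would vanish *)
have rq : 2 * r <= q ^+ 2.
  have -> : 2 * r = q ^+ k by rewrite /r /radius; field.
  by rewrite ler_wiXn2l //; lra.
pose x (i : 'I_((2 ^ k)./2)) : R := 2^-1 - midpoint q k i.
have xbnd i : 2^-1 - q + r <= x i <= 2^-1 - r.
  have [] := midpoint_left_bounds hq0 q1 (ltn_ord i).
  by rewrite -/r /x => *; apply/andP; split; lra.
have x0 i : 0 < x i by have /andP[] := xbnd i; lra.
have xgap (i j : 'I_((2 ^ k)./2)) : (i < j)%N -> 2 * r < x i - x j.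
  move=> ij; suff : midpoint q k i + r < midpoint q k j - r by rewrite /x; lra.
  by apply: midpoint_gap => //; rewrite ij; have := ltn_ord j; lia.
have BE i j : B i j = - ln (square_gap x r i j).
  have xE l : 2^-1 - w (cast_ord (esym (expn2_halves hk)) (lshift _ l)) = x l.
    by rewrite wE.
  rewrite /B fold_logdist_mxE ?xE //; first by rewrite /square_gap !xE.
    rewrite neq_ltn => /orP[] /xgap; first by move=> ?; apply/eqP; lra.
    by move=> ?; apply/eqP; lra.
  rewrite wE /= addnBA //.
  have -> : ((2 ^ k)./2 + (2 ^ k)./2 = 2 ^ k)%N by rewrite -expn2_halves.
  rewrite midpoint_reflect /x; first by lra.
  by have := ltn_ord j; lia.
have lnN (a : R) : 0 < a -> ln (1 / a) = - ln a by move=> a0; rewrite div1r lnV.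
have G0 i j : 0 < square_gap x r i j by apply: square_gap_gt0.
have BC i j : B i j = B j i by rewrite !BE square_gapC.
have Bdecr (i j j' : 'I_((2 ^ k)./2)) : (j < j' <= i)%N -> B i j < B i j'.
  by move=> h; rewrite !BE ltrN2 ltr_ln ?posrE // square_gap_decr.
have Bincr (i j j' : 'I_((2 ^ k)./2)) : (i <= j < j')%N -> B i j' < B i j.
  by move=> h; rewrite !BE ltrN2 ltr_ln ?posrE // square_gap_incr.
split; last first.
  by do !split => //; move=> j i i' h; rewrite ![B _ j]BC; [apply: Bdecr|apply: Bincr].
move=> i j.
have p0 : 0 < q - 2 * r by nra.
have c1 : 0 < q * (1 - q) by apply: mulr_gt0; lra.
have c2 : 0 < (1 - q) * (q - 2 * r) by apply: mulr_gt0; lra.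
have c3 : 0 < r * (1 - 2 * q + 2 * r) by apply: mulr_gt0; lra.
have c4 : 0 < r * (1 - 2 * q) by apply: mulr_gt0; lra.
rewrite !lnN // BE !lerN2 !ltrN2 !ltr_ln ?posrE // !ler_ln ?posrE //; split.
- by nra.
- have -> : (1 - q) * (q - 2 * r) = (2^-1 - r) ^+ 2 - (2^-1 - q + r) ^+ 2 by field.
  apply: square_gap_le => //; first by lra.
  (* the diagonal value increases with r and the bound decreases, so the worst
     case is 2 * r = q ^ 2, where the claim reads q ^ 2 + 3 * q <= 2 *)
  have h1 : 2 * r * (2^-1 - r) <= q ^+ 2 * 2^-1 * (1 - q ^+ 2) by nra.
  have h2 : q * (1 - q) ^+ 2 <= (2^-1 - r) ^+ 2 - (2^-1 - q + r) ^+ 2 by nra.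
  have h3 : q ^+ 2 * 2^-1 * (1 - q ^+ 2) <= q * (1 - q) ^+ 2.
    have -> : q ^+ 2 * 2^-1 * (1 - q ^+ 2) = q * (1 - q) * (q * (1 + q) / 2) by field.
    have -> : q * (1 - q) ^+ 2 = q * (1 - q) * (1 - q) by ring.
    by rewrite ler_pM2l //; nra.
  by lra.
- have -> : r * (1 - 2 * q + 2 * r) = 2 * r * (2^-1 - q + r) by field.
  by apply: square_gap_ge => // l; have /andP[] := xbnd l.
- by nra.
Qed.
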